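(* Let $G$ be a locally finite group with $|G| = \aleph_1$, and let $A$ be a $\mathbb{Z}$-module. Then $\mathrm{H}^2(G, AG)$ has a subgroup isomorphic to $A^{\aleph_1}$, and $|\mathrm{H}^2(G, AG)| = |A^G| = |A|^{\aleph_1}$.
   Context: A group is locally finite if each of its finitely generated subgroups is finite. $A$ is viewed as having trivial $G$-action, and $AG$ denotes the induced left $\mathbb{Z}G$-module $\mathbb{Z}G\otimes_{\mathbb{Z}}A$. $A^{\aleph_1}$ denotes the direct product of $\aleph_1$ copies of $A$, and $A^G$ denotes the set of all functions from $G$ to $A$. *)

(* Defs.v *)
From HB Require Import structures.
From mathcomp Require Import all_boot all_order all_algebra.
From mathcomp Require Import finmap.
From mathcomp Require Import all_classical.
From mathcomp Require Import wochoice.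
From mathcomp Require Import monalg.

Set Implicit Arguments.
Unset Strict Implicit.
Unset Printing Implicit Defensive.

Import GRing.Theory.

Local Open Scope classical_set_scope.
Local Open Scope ring_scope.

Definition gen_subgroup (G : groupType) (S : set G) : set G :=
  smallest (fun H : set G => group_closed (mem H)) S.

Definition locally_finite (G : groupType) : Prop :=
  forall s : seq G, finite_set (gen_subgroup [set` s]).

(* T can be well-ordered in the order type of the least uncountable ordinal:
   T is uncountable while all proper initial segments are countable. *)
Definition card_aleph1 (T : Type) : Prop :=
  ~ countable [set: T] /\
  exists R : rel T, well_order R /\
    forall x : T, countable [set y | R y x /\ y <> x].

(* A left G-module, i.e. a left module over the integral group ring of G. *)
Record gmodule (G : groupType) := GModule {
  gmodule_zmod :> zmodType;
  gact : G -> {additive gmodule_zmod -> gmodule_zmod};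
  gact1 : forall x, gact 1%g x = x;
  gactM : forall g h x, gact (g * h)%g x = gact g (gact h x) }.

Section GroupCohomology.
Variables (G : groupType) (M : gmodule G).

(* Inhomogeneous (non-normalized) cochains: Hom over ZG from the bar
   resolution of the trivial module Z to M. *)
Definition cochain (n : nat) : Type := ('I_n -> G) -> M.
HB.instance Definition _ n := GRing.Zmodule.on (cochain n).

(* (s_0, ..., s_n) |-> (s_0, ..., s_i * s_(i+1), ..., s_n) *)
Definition bar_mul n (i : 'I_n) (s : 'I_n.+1 -> G) : 'I_n -> G := fun j =>
  if (j < i)%N then s (widen_ord (leqnSn n) j)
  else if j == i then (s (widen_ord (leqnSn n) j) * s (lift ord0 j))%g
  else s (lift ord0 j).

Definition cobd n (f : cochain n) : cochain n.+1 := fun s =>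
  gact M (s ord0) (f (fun j => s (lift ord0 j)))
  + \sum_(i < n) f (bar_mul i s) *~ (-1) ^+ i.+1
  + f (fun j => s (widen_ord (leqnSn n) j)) *~ (-1) ^+ n.+1.

Lemma cobd_is_zmod_morphism n : zmod_morphism (@cobd n).
Proof.
move=> f f'; apply/funext => s.
rewrite [RHS]/(cobd f s - cobd f' s) /cobd !opprD raddfB /= mulrzBl.
under eq_bigr do rewrite mulrzBl.
by rewrite sumrB [RHS]addrACA; congr (_ + _); rewrite addrACA.
Qed.
HB.instance Definition _ n :=
  GRing.isZmodMorphism.Build (cochain n) (cochain n.+1) (@cobd n)
    (@cobd_is_zmod_morphism n).

Definition is_cocycle n : {pred cochain n} := fun f => cobd f == 0.

Lemma is_cocycle_zmod_closed n : zmod_closed (@is_cocycle n).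
Proof.
split=> [|f f']; rewrite /is_cocycle !unfold_in ?raddf0 //.
by move=> /eqP Hf /eqP Hf'; rewrite raddfB /= Hf Hf' subrr.
Qed.
HB.instance Definition _ n :=
  GRing.isZmodClosed.Build (cochain n) (@is_cocycle n)
    (@is_cocycle_zmod_closed n).

Record cocycle n := Cocycle {
  cocycle_val :> cochain n;
  cocycleP : cocycle_val \in @is_cocycle n }.
HB.instance Definition _ n := [isSub for @cocycle_val n].
HB.instance Definition _ n := [Choice of cocycle n by <:].
HB.instance Definition _ n := [SubChoice_isSubZmodule of cocycle n by <:].

(* Coboundaries are cut out inside the cocycles, so that cohomology is Z^n/B^n;
   cobd_cobd1 below checks that for n = 2 no coboundary is lost. *)
Definition is_coboundary n : {pred cocycle n} :=
  match n return cocycle n -> bool with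
  | 0 => fun z => z == 0
  | m.+1 => fun z => `[< exists c : cochain m, val z = cobd c >]
  end.

Lemma is_coboundary_zmod_closed n : zmod_closed (@is_coboundary n).
Proof.
case: n => [|n]; split; rewrite ?unfold_in //=.
- by move=> x y; rewrite !unfold_in /= => /eqP-> /eqP->; rewrite subrr.
- by apply/asboolP; exists 0; rewrite raddf0.
- move=> x y; rewrite !unfold_in /= => /asboolP[c Hc] /asboolP[d Hd].
  by apply/asboolP; exists (c - d); rewrite raddfB /= -Hc -Hd.
Qed.
HB.instance Definition _ n :=
  GRing.isZmodClosed.Build (cocycle n) (@is_coboundary n)
    (@is_coboundary_zmod_closed n).

Definition cohomology n : zmodType := {ideal_quot @is_coboundary n}.

Lemma cobd1E (c : cochain 1) (s : 'I_2 -> G) :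
  cobd c s = gact M (s ord0) (c (fun=> s ord_max))
             - c (fun=> (s ord0 * s ord_max)%g) + c (fun=> s ord0).
Proof.
rewrite /cobd big_ord1 expr1 mulrN1z sqrrN expr1n mulr1z.
congr (gact M _ (c _) - c _ + c _); apply/funext => j; rewrite (ord1 j).
- by congr s; apply/val_inj.
- by rewrite /bar_mul /=; congr (s _ * s _)%g; apply/val_inj.
- by congr s; apply/val_inj.
Qed.

Definition pair_fun (g h : G) : 'I_2 -> G := fun i => if i == ord0 then g else h.

Lemma cobd2E (f : cochain 2) (s : 'I_3 -> G) :
  let g := s ord0 in let h := s (lift ord0 ord0) in let k := s ord_max in
  cobd f s = gact M g (f (pair_fun h k)) - f (pair_fun (g * h)%g k)
             + f (pair_fun g (h * k)%g) - f (pair_fun g h).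
Proof.
move=> g h k; rewrite /cobd big_ord_recl big_ord1 /= expr1 mulrN1z.
rewrite sqrrN expr1n mulr1z -signr_odd /= expr1 mulrN1z addrA.
congr (gact M _ (f _) - f _ + f _ - f _); apply/funext => j;
  rewrite /pair_fun /bar_mul /g /h /k; case: j => [[|[|//]] Hj] /=;
  rewrite -?val_eqE /=; congr s + congr (_ * _)%g; do ?congr s; exact/val_inj.
Qed.

Lemma cobd_cobd1 (c : cochain 1) : cobd (cobd c) = 0.
Proof.
apply/funext => s; rewrite cobd2E !cobd1E /pair_fun /= !(raddfD, raddfB) /=.
rewrite -gactM mulgA [RHS]/(0 : M).
rewrite raddfN /= !opprK !addrA.
by rewrite [LHS](ACl (1*4*7*2*3*10*5*8*11*6*9*12))/= !addrK subrr.
Qed.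

End GroupCohomology.

Section Induced.
Variables (G : groupType).

Section Translation.
Variable (A : zmodType).

(* g . (sum_k a_k k) = sum_k a_k (g k) *)
Definition ltrans (g : G) (x : {malg A[G]}) : {malg A[G]} :=
  [malg h in [fset (g * k)%g | k in msupp x]%fset => x@_(g^-1 * h)%g].

Lemma mcoeff_ltrans g x h : (ltrans g x)@_h = x@_(g^-1 * h)%g.
Proof.
rewrite mcoeffE; case: ifPn => // /negP Hh; apply/esym/mcoeff_outdom/negP => Hk.
by apply: Hh; apply/imfsetP; exists (g^-1 * h)%g => //=; rewrite mulVKg.
Qed.

Lemma ltrans_is_zmod_morphism g : zmod_morphism (ltrans g).
Proof. by move=> x y; apply/malgP => h; rewrite !(mcoeff_ltrans, mcoeffB). Qed.
HB.instance Definition _ g :=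
  GRing.isZmodMorphism.Build {malg A[G]} {malg A[G]} (ltrans g)
    (ltrans_is_zmod_morphism g).

Lemma ltrans1 x : ltrans 1%g x = x.
Proof. by apply/malgP => h; rewrite mcoeff_ltrans invg1 mul1g. Qed.

Lemma ltransM g h x : ltrans (g * h)%g x = ltrans g (ltrans h x).
Proof. by apply/malgP => k; rewrite !mcoeff_ltrans invgM mulgA. Qed.

Definition induced : gmodule G :=
  @GModule G {malg A[G]} (fun g => ltrans g : {additive _ -> _}) ltrans1 ltransM.

End Translation.

(* induced A, made of the finitely supported functions G -> A, is the tensor
   product over Z of ZG = {malg int[G]} and A via tens, with G acting by left
   multiplication on ZG: see gact_tens and tens_universal. *)
Variable (A : zmodType).

Definition tens (r : {malg int[G]}) (a : A) : induced A :=
  [malg k in msupp r => a *~ r@_k].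

Lemma mcoeff_tens r a k : (tens r a : {malg A[G]})@_k = a *~ r@_k.
Proof. by rewrite mcoeffE; case: msuppP => // _; rewrite mulr0z. Qed.

Lemma tensBl a : zmod_morphism (tens^~ a).
Proof. by move=> r r'; apply/malgP => k; rewrite !(mcoeff_tens, mcoeffB) mulrzBr. Qed.

Lemma tensBr r : zmod_morphism (tens r).
Proof. by move=> a b; apply/malgP => k; rewrite !(mcoeff_tens, mcoeffB) mulrzBl. Qed.

Lemma gact_tens g r a : gact (induced A) g (tens r a) = tens (ltrans g r) a.
Proof. by apply/malgP => k; rewrite !(mcoeff_ltrans, mcoeff_tens). Qed.

Lemma tens_universal (W : zmodType) (b : {malg int[G]} -> A -> W)
    (bBl : forall a, zmod_morphism (b^~ a)) (bBr : forall r, zmod_morphism (b r)) :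
  exists F : {additive induced A -> W}, (forall r a, F (tens r a) = b r a) /\
    forall F' : {additive induced A -> W},
      (forall r a, F' (tens r a) = b r a) -> F' =1 F.
Proof.
pose addl a : {additive _ -> _} := HB.pack (b^~ a)
  (GRing.isZmodMorphism.Build _ _ (b^~ a) (bBl a)).
pose addr r : {additive _ -> _} := HB.pack (b r)
  (GRing.isZmodMorphism.Build _ _ (b r) (bBr r)).
pose F (x : {malg A[G]}) : W := \sum_(k <- msupp x) addr << k >> x@_k.
have FEw (x : {malg A[G]}) (D : {fset G}) : (msupp x `<=` D)%fset ->
    F x = \sum_(k <- D) addr << k >> x@_k.
  move=> xD; apply: big_fset_incl => // k _ /mcoeff_outdom ->.
  by rewrite raddf0.
have F_add : zmod_morphism F.
  move=> x y; pose D := (msupp x `|` msupp y)%fset.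
  rewrite (FEw (x - y) D) ?msuppB_le // (FEw x D) ?fsubsetUl //.
  rewrite (FEw y D) ?fsubsetUr // -sumrB; apply: eq_bigr => k _.
  by rewrite mcoeffB raddfB.
pose Fa : {additive induced A -> W} :=
  HB.pack F (GRing.isZmodMorphism.Build _ _ F F_add).
have tensE r a : tens r a = \sum_(k <- msupp r) tens << k >> (a *~ r@_k).
  apply/malgP => k; rewrite raddf_sum /= mcoeff_tens.
  under eq_bigr do rewrite mcoeff_tens mcoeffU.
  case: msuppP => [kr|kr].
    rewrite (big_fsetD1 k) //= eqxx mulr1z big1_fset ?addr0 // => j.
    by rewrite !inE => /andP[/negPf-> _].
  rewrite big1_fset // => j jr _; case: eqP => // jk.
  by move: kr; rewrite -jk jr.
have bE r a : b r a = \sum_(k <- msupp r) b << k >> (a *~ r@_k).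
  rewrite -[LHS]/(addl a r) [in LHS](monalgE r) raddf_sum.
  apply: eq_bigr => k _ /=.
  rewrite -[RHS]/(addr << k >> _) raddfMz /= -[RHS]/(addl a << k >> *~ _).
  by rewrite -raddfMz /= -[in LHS](intz r@_k) -raddfMz.
exists Fa; split => [r a|F' HF' x].
  rewrite bE -[LHS]/(F _) (FEw _ (msupp r)).
    by apply: eq_bigr => k _; rewrite mcoeff_tens.
  apply/fsubsetP => k; rewrite -!mcoeff_neq0 mcoeff_tens.
  by apply: contra_neq => ->; rewrite mulr0z.
rewrite -[RHS]/(F x) {1}(monalgE x) raddf_sum; apply: eq_bigr => k _.
rewrite -[RHS]HF'; congr (F' _); apply/malgP => j.
by rewrite mcoeff_tens !mcoeffU; case: eqP => _; rewrite ?mulr1z ?mulr0z.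
Qed.

End Induced.

(* Main.v *)
Require Import Defs.
From HB Require Import structures.
From mathcomp Require Import all_boot all_order all_algebra.
From mathcomp Require Import finmap.
From mathcomp Require Import all_classical.
From mathcomp Require Import monalg.

(** The functions [G -> A] form the coinduced module, whose cohomology vanishes
    in positive degrees, and the induced module [AG] is its submodule of
    finitely supported functions.  Hence a class in [H^2(G, AG)] is a 1-cocycle
    of [G] with values in functions modulo finitely supported ones.  Call a
    function [u] on [G] almost invariant under [g] when [u (g x) = u x] for all
    but finitely many [x].  A 1-cocycle modulo finite functions arises from
    functions [f g], indexed by the elements of [G] themselves, such that, along
    a well-order of [G] of type omega_1, the difference of [f al] and [f be] is
    almost invariant under every [g] with [g <= al] and [g <= be]: the cocycle
    is [g |-> g (f g) - f g].  Its class is zero exactly when one function [F]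
    replaces all the [f g], that is, when [F - f g] is almost invariant under
    [g] for each [g] ([connecting_cocycle]).

    The family is built by transfinite recursion, [f de = v de + d de].  Here
    [v de] is a limit of the countably many earlier functions; it exists because
    a countable locally finite group is an increasing union of finite groups
    ([almost_inv_limit]; this is where [H^2] of countable locally finite groups
    vanishes).  The function [d de] may be anything that is almost invariant
    under the elements below [de], and it is there to prevent a global [F].
    Given [F], a closing-off argument produces [de] such that the elements below
    [de] form a subgroup [H], and such that, outside [H], the function [v de]
    vanishes and [F] is exactly [H]-invariant.  So it is enough that no
    [H]-invariant function outside [H] differs from [d de] by something almost
    invariant under [de] ([unabsorbable_function]).  Such a [d de] consists of
    indicators of finite subgroups exhausting [H], moved far away from each
    other; if it could be absorbed, a ping-pong argument would give an element
    of infinite order ([pingpong]), contrary to local finiteness.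

    For a homomorphism [A^G -> H^2(G, AG)] the whole construction is carried out
    with values in functions [(G -> A) -> A], the parameter [a : G -> A] being
    the argument: the indicators in [d de] carry the coordinates [a |-> a i] for
    all [i] below [de], each infinitely often.  If the class of [a] vanishes,
    then [a i = 0] for every [i], since [de] may be taken above [i].

    For the cardinalities, a class is determined by the values of a cocycle, a
    function on the cube of [G], and the cube of [G] injects into [G]; types of
    order type omega_1 inject into each other; Cantor-Bernstein concludes. *)

Set Implicit Arguments.
Unset Strict Implicit.
Unset Printing Implicit Defensive.

Import GRing.Theory.

Local Open Scope classical_set_scope.
Local Open Scope card_scope.
Local Open Scope ring_scope.

(** * Orders of type omega_1 *)

Lemma ex_least (P : nat -> Prop) : (exists n, P n) ->
  exists2 N, P N & forall m, (m < N)%N -> ~ P m.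
Proof.
move=> [n Pn]; have [N /asboolP PN Nmin] := @ex_minnP (fun n => `[< P n >])
  (ex_intro _ n (asboolT Pn)).
by exists N => // m mN /asboolT/Nmin; rewrite leqNgt mN.
Qed.

(** The relations [lt] with this property are the strict parts of the
    well-orders in which all proper initial segments are countable. *)
Definition omega1_order (T : Type) (lt : T -> T -> Prop) : Prop :=
  [/\ well_founded lt,
      forall x y z, lt x y -> lt y z -> lt x z,
      forall x y, x <> y -> lt x y \/ lt y x &
      forall x, countable [set y | lt y x]].

Lemma card_aleph1_order (T : Type) : card_aleph1 T ->
  ~ countable [set: T] /\ exists lt : T -> T -> Prop, omega1_order lt.
Proof.
case=> ncT [R [woR segR]]; split=> //.
have minR (P : set T) x : P x -> exists2 z, P z & forall y, P y -> R z y.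
  move=> Px; have [|z [[]]] := woR (fun x => `[< P x >]).
    by exists x; apply/asboolP.
  by move=> /asboolP Pz zP _; exists z => // y Py; apply/zP/asboolP.
have Rtot x y : R x y \/ R y x.
  have [z [->|->] zP] := minR [set x; y] x (or_introl erefl).
    by left; apply: zP; right.
  by right; apply: zP; left.
have Rxx x : R x x by case: (Rtot x x).
have Ras x y : R x y -> R y x -> x = y.
  move=> xy yx; have [|z [_ zu]] := woR (fun t => `[< t = x \/ t = y >]).
    by exists x; apply/asboolP; left.
  have -> : x = z.
    apply/esym/zu; split; first by apply/asboolP; left.
    by move=> t /asboolP[->|->].
  apply/zu; split; first by apply/asboolP; right.
  by move=> t /asboolP[->|->].
exists (fun x y => R x y /\ x <> y); split.
- move=> x; apply: contrapT => nx.
  have [z nz zP] := minR [set x | ~ Acc (fun x y => R x y /\ x <> y) x] x nx.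
  apply: nz; constructor=> y [yz nyz]; apply: contrapT => /zP zy.
  exact/nyz/Ras.
- move=> x y z [xy nxy] [yz nyz].
  have [t [[->|->]|->] tP] := minR [set x; y; z] x (or_introl (or_introl erefl)).
  + split; first by apply: tP; right.
    by move=> xz; apply: nxy; apply: Ras => //; rewrite xz.
  + by case: nxy; apply: Ras => //; apply: tP; left; left.
  + by case: nyz; apply: Ras => //; apply: tP; left; right.
- by move=> x y nxy; have [] := Rtot x y; [left|right]; split=> // /esym.
- by move=> x; exact: segR.
Qed.

(** Transfinite recursion for the case where no function performs the step: a
    suitable value at [x] is merely known to exist, and only as long as the
    earlier values were suitable. *)
Lemma wf_choice (T U : Type) (lt : T -> T -> Prop) (u0 : U)
    (Q : T -> (T -> U) -> U -> Prop) :
  well_founded lt ->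
  (forall x f g u, (forall y, lt y x -> f y = g y) -> Q x f u -> Q x g u) ->
  (forall x f, (forall y, lt y x -> Q y f (f y)) -> exists u, Q x f u) ->
  exists f, forall x, Q x f (f x).
Proof.
move=> wf Qext Qstep.
have [e eP] : exists e : T -> (T -> U) -> U,
    forall x f, (exists u, Q x f u) -> Q x f (e x f).
  have /choice[e eP] : forall p : T * (T -> U), exists u,
      (exists u, Q p.1 p.2 u) -> Q p.1 p.2 u.
    move=> [x f]; have [[u Qu]|nQ] := pselect (exists u, Q x f u).
      by exists u.
    by exists u0.
  by exists (fun x f => e (x, f)) => x f /(eP (x, f)).
pose F x (rec : forall y, lt y x -> U) : U :=
  e x (fun y => if pselect (lt y x) is left h then rec y h else u0).
pose f := Fix wf (fun _ => U) F.
have fE x : f x = e x (fun y => if pselect (lt y x) then f y else u0).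
  rewrite {1}/f Fix_eq; first by congr e; apply/funext=> y; case: pselect.
  move=> z g h gh; rewrite /F; congr e; apply/funext=> y.
  by case: pselect => // yz; exact: gh.
exists f; apply: (well_founded_ind wf) => x IH.
have [u Qu] := Qstep x f IH.
rewrite fE.
apply: (Qext x (fun y => if pselect (lt y x) then f y else u0)).
  by move=> y yx; case: pselect.
apply: eP; exists u; apply: Qext Qu => y yx; by case: pselect.
Qed.

(** Iterate adding [phi x y] for all [x], [y] already present.  This does the
    work of closed unbounded sets: an initial segment that reflects countably
    many requirements is obtained by including the predecessors of [x] in
    [phi x x]. *)
Lemma countable_closure (T : Type) (C : set T) (phi : T -> T -> set T) :
  countable C -> (forall x y, countable (phi x y)) ->
  exists V : set T, [/\ countable V, C `<=` V &
    forall x y, V x -> V y -> phi x y `<=` V].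
Proof.
move=> cC cphi.
pose step (D : set T) : set T :=
  D `|` \bigcup_(p in D `*` D) phi p.1 p.2.
pose W n := iter n step C.
have cW n : countable (W n).
  elim: n => // n IH; rewrite /W iterS -/(W n).
  have -> : step (W n) = \bigcup_(b in [set: bool])
      if b then W n else \bigcup_(p in W n `*` W n) phi p.1 p.2.
    apply/seteqP; split=> x.
      by case=> h; [exists true | exists false].
    by case=> -[] _ h; [left | right].
  apply: bigcup_countable; first exact: countableP.
  move=> [] _ //; apply: bigcup_countable; first exact: countableX.
  by move=> p _.
have W_le m n : (m <= n)%N -> W m `<=` W n.
  elim: n => [|n IH]; first by rewrite leqn0 => /eqP->.
  by rewrite leq_eqVlt => /orP[/eqP->//|/IH h x /h Wx]; left.
exists (\bigcup_n W n); split.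
- by exact: bigcup_countable.
- by move=> x Cx; exists 0%N.
- move=> x y [m _ xm] [n _ yn] z xyz; exists (maxn m n).+1 => //.
  right; exists (x, y) => //; split=> /=.
    by apply: W_le xm; exact: leq_maxl.
  by apply: W_le yn; exact: leq_maxr.
Qed.

Lemma countable_setU (T : Type) (A B : set T) :
  countable A -> countable B -> countable (A `|` B).
Proof.
move=> cA cB; rewrite -bigcup2E; by apply: bigcup_countable => // -[|[|n]] _ /=.
Qed.

Lemma countable_image (T U : Type) (f : T -> U) (A : set T) :
  countable A -> countable (f @` A).
Proof. exact/card_le_trans/card_image_le. Qed.

Lemma countable_enum (T : Type) (t0 : T) (C : set T) : countable C -> C t0 ->
  exists e : nat -> T, range e = C.
Proof.
move=> cC Ct0; have /pfcard_geP[C0|[e]] : C #<= [set: nat] by [].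
  by move: Ct0; rewrite C0.
by exists e; apply: image_eq.
Qed.

Lemma uncountable_avoid (T : Type) (C : set T) :
  ~ countable [set: T] -> countable C -> exists x, ~ C x.
Proof.
move=> ncT cC; apply: contrapT => h; apply: ncT.
apply: sub_countable cC; apply: subset_card_le => x _.
by apply: contrapT => nCx; apply: h; exists x.
Qed.

Definition leq_of (T : Type) (lt : T -> T -> Prop) (x y : T) := lt x y \/ x = y.

Lemma leq_of_trans (T : Type) (lt : T -> T -> Prop) x y z : omega1_order lt ->
  leq_of lt x y -> leq_of lt y z -> leq_of lt x z.
Proof.
by move=> [_ tr _ _] [xy|->] // [yz|<-]; left => //; exact: tr yz.
Qed.

Lemma leq_of_ub (T : Type) (lt : T -> T -> Prop) x y z : omega1_order lt ->
  exists m, [/\ leq_of lt x m, leq_of lt y m & leq_of lt z m].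
Proof.
move=> olt; have le_tr := leq_of_trans olt; have [_ _ tri _] := olt.
have ub2 u v : exists m, leq_of lt u m /\ leq_of lt v m.
  have [->|/tri[uv|vu]] := pselect (u = v); first by exists v; split; right.
    by exists v; split; [left|right].
  by exists u; split; [right|left].
have [m [xm ym]] := ub2 x y; have [n [mn zn]] := ub2 m z.
by exists n; split=> //; [exact: le_tr mn|exact: le_tr mn].
Qed.

(** The running maxima of an enumeration of [C].  The sequence may be eventually
    constant, so successors and limits need no separate treatment. *)
Lemma cofinal_sequence (T : Type) (lt : T -> T -> Prop) (C : set T) (t0 : T) :
  omega1_order lt -> countable C -> C t0 ->
  exists s : nat -> T, [/\ forall n, C (s n),
    forall n, leq_of lt (s n) (s n.+1) &
    forall x, C x -> exists n, leq_of lt x (s n)].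
Proof.
move=> [wf tr tri seg] cC Ct0; have [e eE] := countable_enum cC Ct0.
have Ce n : C (e n) by rewrite -eE; exists n.
pose fix s n := if n is m.+1 then
  if pselect (lt (s m) (e m.+1)) then e m.+1 else s m else e 0%N.
exists s; split.
- by elim=> [|n IH] //=; case: pselect => /=.
- by move=> n /=; case: pselect => ? /=; [left|right].
- move=> x; rewrite -eE => -[n _ <-]; exists n.
  case: n => [|n] /=; first by right.
  case: pselect => [|nlt] /=; first by right.
  by have [->|/tri[]//] := pselect (e n.+1 = s n); [right|left].
Qed.

Lemma omega1_segment (T : Type) (lt : T -> T -> Prop) (V : set T) :
  omega1_order lt -> ~ countable [set: T] -> countable V ->
  (forall x y, lt x y -> V y -> V x) -> exists x, V = [set y | lt y x].
Proof.
move=> [wf tr tri seg] ncT cV Vdown; have [x0] := uncountable_avoid ncT cV.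
elim/(well_founded_ind wf): x0 => x IH nVx.
have [[y yx nVy]|h] := pselect (exists2 y, lt y x & ~ V y); first exact: (IH y).
exists x; apply/seteqP; split=> y.
  move=> Vy; have [yx|/tri[//|xy]] := pselect (y = x).
    by case: nVx; rewrite -yx.
  by case: nVx; exact: Vdown Vy.
by move=> yx; apply: contrapT => nVy; apply: h; exists y.
Qed.

Lemma card_leT_ex (T U : Type) (B : set U) :
  [set: T] #<= B <-> exists2 f : T -> U, injective f & forall x, B (f x).
Proof.
split=> [/card_leP[f]|[f finj fB]].
  exists (fun x => set_val (f (to_setT x))) => [x y|x]; last first.
    exact: set_valP.
  move=> h; have {h}fxy : f (to_setT x) = f (to_setT y) by exact: val_inj.
  have := @inj _ _ _ f (to_setT x) (to_setT y) (in_setT _) (in_setT _) fxy.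
  by move=> /(congr1 set_val).
apply: (@card_le_trans _ _ _ (range f)); last first.
  by apply: subset_card_le => _ [x _ <-].
by have /card_esym/card_eqPle[] := @inj_card_eq _ _ [set: T] f (in2W finj).
Qed.

(** Each [x] has only countably many predecessors, hence leaves an uncountable
    part of [Y] from which to choose a fresh sequence.  The factor [nat] gives
    the square of [T] below, and injections between types of order type
    omega_1. *)
Lemma omega1_nat_inj (T Y : Type) (lt : T -> T -> Prop) :
  omega1_order lt -> ~ countable [set: Y] ->
  exists f : T * nat -> Y, injective f.
Proof.
move=> [wf tr tri seg] ncY.
have [y0 _] := uncountable_avoid ncY (countable0 Y).
pose Q (x : T) (f : T -> nat -> Y) (u : nat -> Y) := injective u /\
  forall z, lt z x -> forall m n, u m <> f z n.
have [||f fP] := @wf_choice T (nat -> Y) lt (fun=> y0) Q wf.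
- by move=> x f g u fg [? uf]; split=> // z zx m n; rewrite -fg //; apply: uf.
- move=> x f _.
  pose D := [set f z n | z in [set z | lt z x] & n in [set: nat]].
  have cD : countable D.
    have -> : D = (fun p => f p.1 p.2) @` ([set z | lt z x] `*` [set: nat]).
      apply/seteqP; split=> y.
        by case=> z zx [n _ <-]; exists (z, n).
      by case=> -[z n] /= [zx _] <-; exists z => //; exists n.
    exact/countable_image/countableX.
  have : infinite_set (~` D).
    move=> /finite_set_countable cnD; apply: ncY.
    by rewrite -(setUv D); apply: countable_setU.
  move=> /infiniteP /card_leT_ex[u uinj uD]; exists u; split=> // z zx m n mn.
  by apply: (uD m); rewrite mn; exists z => //; exists n.
exists (fun p => f p.1 p.2) => -[x m] [y n] /= xy.
have ? : x = y.
  apply: contrapT => /tri[h|h].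
    have [_ /(_ _ h)] := fP y; apply; exact: esym xy.
  have [_ /(_ _ h)] := fP x; apply; exact: xy.
by subst y; congr pair; apply: (fP x).1.
Qed.

(** A pair is recovered from its larger entry, the position of the smaller one
    in a fixed enumeration of the countable segment under the larger one, and
    one bit; so it is coded in [T * nat]. *)
Lemma omega1_square_inj (T : Type) (lt : T -> T -> Prop) :
  omega1_order lt -> ~ countable [set: T] ->
  exists f : T * T -> T, injective f.
Proof.
move=> olt ncT; have [g g_inj] := omega1_nat_inj olt ncT.
case: olt => [wf tr tri seg].
have /choice[e eP] : forall x, exists e : T -> nat,
    forall y z, (lt y x \/ y = x) -> (lt z x \/ z = x) -> e y = e z -> y = z.
  move=> x; have : countable ([set y | lt y x] `|` [set x]).
    exact/countable_setU/countable1.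
  by move=> /countable_injP[e einj]; exists e => y z yx zx;
    apply: einj; rewrite inE.
pose q (p : T * T) : T * nat :=
  if pselect (lt p.1 p.2) then (p.2, choice.pickle (true, e p.2 p.1))
  else (p.1, choice.pickle (false, e p.1 p.2)).
exists (g \o q); apply: inj_comp g_inj _ => -[x y] [x' y'].
have pI := pcan_inj (@choice.pickleK (bool * nat)%type).
have le_cases u v : ~ lt u v -> lt v u \/ v = u.
  move=> nuv; have [->|/tri[]] := pselect (v = u); by [right|left|].
rewrite /q /=; case: pselect => xy /=; case: pselect => xy' /= E;
  move: (congr1 fst E) (pI _ _ (congr1 snd E)) => //= {E}.
  by move=> y'E [exE]; subst y'; congr pair; apply: eP exE; left.
by move=> x'E [eyE]; subst x'; congr pair; apply: eP eyE; apply: le_cases.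
Qed.

(** * Subgroups of locally finite groups *)

Section Subgroups.
Variable G : groupType.
Implicit Types (H S : set G) (g h k : G).
Local Open Scope group_scope.

Definition subgroup H : Prop :=
  [/\ H 1, forall x y, H x -> H y -> H (x * y) & forall x, H x -> H x^-1].

Lemma subgroupP H : group_closed (mem H) <-> subgroup H.
Proof.
split=> [Hc|[H1 HM HV]]; last first.
  split; first by rewrite inE.
  by move=> x y; rewrite !inE => Hx Hy; apply/HM/HV.
have H1 := Hc.1; have HM := group_closedM Hc; have HV := group_closedV Hc.
split; first by move: H1; rewrite inE.
- by move=> x y Hx Hy; have := HM x y; rewrite !inE; apply.
- by move=> x Hx; have := HV x; rewrite !inE; apply.
Qed.

Lemma subgroup_mull H g x : subgroup H -> H g -> H (g * x) <-> H x.
Proof.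
move=> [H1 HM HV] Hg; split=> [Hgx|/(HM _ _ Hg)//].
by rewrite -(mulKg g x); apply: HM => //; apply: HV.
Qed.

Lemma subgroup_mulr H g x : subgroup H -> H g -> H (x * g) <-> H x.
Proof.
move=> [H1 HM HV] Hg; split=> [Hgx|/HM/(_ Hg)//].
by rewrite -(mulgK g x); apply: HM => //; apply: HV.
Qed.

Lemma sub_gen_subgroup S : S `<=` gen_subgroup S.
Proof. exact: sub_smallest. Qed.

Lemma gen_subgroup_sub S H : subgroup H -> S `<=` H -> gen_subgroup S `<=` H.
Proof. by move=> /subgroupP Hc; apply: smallest_sub. Qed.

Lemma gen_subgroupP S : subgroup (gen_subgroup S).
Proof.
split.
- by move=> H [/subgroupP[]].
- move=> x y Sx Sy H Hc; have [_ HM _] := (subgroupP H).1 Hc.1.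
  by apply: HM; [apply: Sx|apply: Sy].
- move=> x Sx H Hc; have [_ _ HV] := (subgroupP H).1 Hc.1.
  by apply: HV; apply: Sx.
Qed.

Lemma gen_subgroup_mono S T : S `<=` T -> gen_subgroup S `<=` gen_subgroup T.
Proof.
move=> ST; apply: gen_subgroup_sub; first exact: gen_subgroupP.
exact: subset_trans (@sub_gen_subgroup T).
Qed.

Lemma countable_subgroup (C : set G) : countable C ->
  exists M : set G, [/\ countable M, C `<=` M & subgroup M].
Proof.
move=> cC.
have [||M [cM CM Mc]] := @countable_closure _ (1 |` C)
    (fun x y => [set x * y; x^-1]).
- exact/countable_setU.
- by move=> x y; apply: finite_set_countable; apply: finite_set2.
exists M; split=> //; first by move=> x Cx; apply: CM; right.
split; first by apply: CM; left.
  by move=> x y Mx My; apply: (Mc x y) => //; left.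
by move=> x Mx; apply: (Mc x x) => //; right.
Qed.

(** [K n] is generated by those of the first [n] elements of an enumeration that
    lie in [E n]; an increasing family [E] rather than a single set is what
    limits of functions require. *)
Lemma subgroup_exhaustion (E : nat -> set G) : locally_finite G ->
  (forall m n, (m <= n)%N -> E m `<=` E n) -> countable (\bigcup_n E n) ->
  exists K : nat -> set G, [/\ forall n, finite_set (K n),
    forall n, subgroup (K n), forall n, K n `<=` gen_subgroup (E n),
    forall m n, (m <= n)%N -> K m `<=` K n &
    forall m g, E m g -> exists N, forall n, (N <= n)%N -> K n g].
Proof.
move=> lfG Ele cE.
have [e eE] : exists e : nat -> G, \bigcup_n E n `<=` range e.
  have [] := @countable_enum _ 1 (1 |` \bigcup_n E n).
  - exact/countable_setU.
  - by left.
  by move=> e eE; exists e; rewrite eE => x; right.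
pose s n := [seq e j | j <- iota 0 n & `[< E n (e j) >]].
have sP n g : g \in s n <-> exists j, [/\ (j < n)%N, E n (e j) & g = e j].
  split.
    move=> /mapP[j].
    rewrite mem_filter mem_iota add0n => /andP[/asboolP Ej jn] gE.
    by exists j.
  move=> [j [jn Ej ->]].
  apply: map_f; rewrite mem_filter mem_iota add0n jn leq0n !andbT.
  exact/asboolP.
exists (fun n => gen_subgroup [set` s n]); split.
- by move=> n; apply: lfG.
- by move=> n; apply: gen_subgroupP.
- by move=> n; apply: gen_subgroup_mono => g /sP[j [_ Ej ->]].
- move=> m n mn; apply: gen_subgroup_mono => g /sP[j [jm Ej ->]].
  by apply/sP; exists j; split=> //; [exact: leq_trans mn|exact: Ele Ej].
- move=> m g Emg; have [|j _ ej] := eE g; first by exists m.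
  exists (maxn m j.+1) => n; rewrite geq_max => /andP[mn jn].
  apply: sub_gen_subgroup; apply/sP; exists j; split=> //.
  by apply: (Ele m n mn); rewrite ej.
Qed.

Lemma locally_finite_torsion g : locally_finite G -> exists n, g ^+ n.+1 = 1.
Proof.
move=> lfG; have [H1 HM _] := gen_subgroupP [set` [:: g]].
have gH n : gen_subgroup [set` [:: g]] (g ^+ n).
  elim: n => [|n IH]; rewrite ?expg0 // expgS; apply: HM IH.
  by apply: sub_gen_subgroup; rewrite /= mem_seq1.
apply: contrapT => gn; have /finite_setPn := lfG [:: g]; apply.
apply/card_leT_ex; exists (fun n => g ^+ n) => // m n.
wlog mn : m n / (m <= n)%N => [th|].
  by case: (leqP m n) => [/th//|/ltnW/th h /esym/h].
move: (mn); rewrite leq_eqVlt => /orP[/eqP//|lt_mn E]; case: gn.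
exists (n - m).-1; rewrite prednK ?subn_gt0 //.
by apply: (mulIg (g ^+ m)); rewrite mul1g -expgnDr subnK.
Qed.

(** Follow the points [h], [hkh], [hkhkh], ...  A point outside [P] stays
    outside [P] under [k], and also under [h] unless [k] has brought it into
    [H].  Up to the first return to [H] all points are therefore outside [P].
    But the last point before the return lies in the coset [H k^-1], which is
    disjoint from [H] and so contained in [P] or disjoint from [P]; it contains
    [k^-1], which is in [P] because [1] is.  If [h k] had finite order there
    would be such a return.  Geometrically, [P] shows
    that [h] separates two blocks at a cut vertex of the coset graph of [H] and
    [k], and alternating between blocks never closes up. *)
Lemma pingpong (H P : set G) k h : subgroup H -> ~ H k ->
  (forall x, P (k * x) <-> P x) ->
  (forall g x, H g -> ~ H x -> P x -> P (g * x)) ->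
  P 1 -> H h -> ~ P h -> forall n, (h * k) ^+ n.+1 <> 1.
Proof.
move=> Hs nHk Pk PH P1 Hh nPh n hkn.
have [H1 HM HV] := Hs.
pose b i := k * (h * k) ^+ i.
have Hb : H (b n).
  rewrite -(subgroup_mull _ Hs Hh) /b mulgA -expgS hkn; exact: H1.
have [i Hbi imin] := ex_least (ex_intro (fun i => H (b i)) n Hb).
(* [i] is the time of the first return. *)
have nP m : (m <= i)%N -> ~ P ((h * k) ^+ m * h).
  elim: m => [|m IH] mi; first by rewrite expg0 mul1g.
  have nPz := IH (ltnW mi); set z := _ * h in nPz.
  have nHkz : ~ H (k * z).
    by rewrite /z mulgA subgroup_mulr //; exact: imin.
  rewrite expgS -mulgA -/z -mulgA => Phkz; apply: nPz; apply/Pk.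
  rewrite -(mulKg h (k * z)); apply: PH => //; first exact: HV.
  by rewrite subgroup_mull.
have nPz := nP i (leqnn i); set z := _ * h in nPz.
have Hzk : H (z * k).
  by rewrite /z -mulgA -expgSr expgS -mulgA subgroup_mull.
apply: nPz; rewrite -(mulgK k z); apply: PH => //.
  by move=> /HV; rewrite invgK.
by apply/Pk; rewrite mulgV.
Qed.

End Subgroups.

(** * Almost invariant functions *)

Section AlmostInvariant.
Variable G : groupType.

Definition almost_inv (B : Type) (g : G) (u : G -> B) : Prop :=
  finite_set [set x | u (g * x)%g <> u x].

Lemma finite_preimage_mul (g : G) (F : set G) :
  finite_set F -> finite_set [set x | F (g * x)%g].
Proof.
move=> fF; apply: (sub_finite_set _ (finite_image (fun x => g^-1 * x)%g fF)).
by move=> x Fx; exists (g * x)%g => //; rewrite mulKg.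
Qed.

Lemma almost_inv_subgroup (B : Type) (u : G -> B) :
  subgroup [set g | almost_inv g u].
Proof.
split.
- by apply: sub_finite_set (finite_set0 _) => x /=; rewrite mul1g.
- move=> g h gu hu.
  apply: (@sub_finite_set _ _ ([set x | u (g * (h * x))%g <> u (h * x)%g] `|`
     [set x | u (h * x)%g <> u x])).
    move=> x /= gh; apply: contrapT => /not_orP[/contrapT E1 /contrapT E2].
    by apply: gh; rewrite -mulgA E1 E2.
  rewrite finite_setU; split=> //.
  exact: (@finite_preimage_mul h [set x | u (g * x)%g <> u x]).
- move=> g gu; rewrite /= /almost_inv.
  apply: sub_finite_set (finite_preimage_mul g^-1 gu) => x /= ux.
  by rewrite mulVKg => /esym.
Qed.

Lemma almost_inv_gen (B : Type) (u : G -> B) (S : set G) g :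
  (forall s, S s -> almost_inv s u) -> gen_subgroup S g -> almost_inv g u.
Proof.
by move=> Su; apply: gen_subgroup_sub Su g; exact: almost_inv_subgroup.
Qed.

Lemma almost_inv0 (B : zmodType) g : almost_inv g (0 : G -> B).
Proof. by apply: sub_finite_set (finite_set0 G) => x /=. Qed.

Lemma almost_invD (B : zmodType) g (u v : G -> B) :
  almost_inv g u -> almost_inv g v -> almost_inv g (u + v).
Proof.
move=> gu gv.
have : finite_set ([set x | u (g * x)%g <> u x] `|` [set x | v (g * x)%g <> v x]).
  by rewrite finite_setU.
apply: sub_finite_set => x /= uv.
apply: contrapT => /not_orP[/contrapT E1 /contrapT E2]; apply: uv.
by rewrite -[LHS]/(u (g * x)%g + v (g * x)%g) E1 E2.
Qed.

End AlmostInvariant.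

(** A direct form of the vanishing of [H^2] for countable locally finite groups.
    With finite sets [Phi n], invariant under finite groups [K n] and exhausting
    the supports, let [v] be [u n] on the points that first appear in [Phi n].
    Enlarging [Phi n] by the finitely many points where [u n.+1 - u n] fails to
    be [K n]-invariant makes [v - u n] invariant under [g] in [E n] up to one of
    the finite sets [Phi m] and finitely many differences [u m.+1 - u m]. *)
Lemma almost_inv_limit (G : groupType) (B : zmodType) (E : nat -> set G)
    (u : nat -> G -> B) :
  locally_finite G ->
  (forall m n, (m <= n)%N -> E m `<=` E n) -> countable (\bigcup_n E n) ->
  (forall n, countable [set x | u n x <> 0]) ->
  (forall n g, E n g -> almost_inv g (u n.+1 - u n)) ->
  exists v : G -> B, (forall x, v x = 0 \/ exists n, v x = u n x) /\
    forall n g, E n g -> almost_inv g (v - u n).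
Proof.
move=> lfG Ele cE cu Eu.
have [K [fK Ks KE Kle EK]] := subgroup_exhaustion lfG Ele cE.
have [xs xsP] : exists xs : nat -> G,
    forall n x, u n x <> 0 -> exists j, x = xs j.
  have [] := @countable_enum _ 1%g (1%g |` \bigcup_n [set x | u n x <> 0]).
  - exact/countable_setU/bigcup_countable.
  - by left.
  move=> xs xsE; exists xs => n x ux.
  have : range xs x by rewrite xsE; right; exists n.
  by case=> j _ <-; exists j.
pose F n := \bigcup_(g in K n)
  [set x | (u n.+1 - u n) (g * x)%g <> (u n.+1 - u n) x].
have fF n : finite_set (F n).
  apply: bigcup_finite => // g Kg; apply: (@almost_inv_gen _ _ _ (E n)).
    by move=> s; apply: Eu.
  exact: KE.
pose Y n := \bigcup_(m in `I_n.+1) (F m `|` [set xs m]).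
have fY n : finite_set (Y n).
  by apply: bigcup_finite => // m _; rewrite finite_setU.
pose Phi n := [set (k * y)%g | k in K n & y in Y n].
have fPhi n : finite_set (Phi n) by apply: finite_image2.
have PhiK n k x : K n k -> Phi n (k * x)%g <-> Phi n x.
  have [_ KM KV] := Ks n; move=> Kk; split.
    move=> [k' Kk' [y Yy E1]]; exists (k^-1 * k')%g.
      by apply/KM => //; exact: KV.
    by exists y => //; rewrite -mulgA E1 mulKg.
  move=> [k' Kk' [y Yy <-]]; exists (k * k')%g; first exact: KM.
  by exists y => //; rewrite mulgA.
have Phile m n : (m <= n)%N -> Phi m `<=` Phi n.
  move=> mn _ [k Kk [y [j jm Yy] <-]]; exists k; first exact: Kle Kk.
  by exists y => //; exists j => //=; apply: leq_trans jm _; rewrite ltnS.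
have FPhi n : F n `<=` Phi n.
  move=> x Fx; have [K1 _ _] := Ks n; exists 1%g => //.
  exists x; last by rewrite mul1g.
  by exists n => /=; [exact: ltnSn|left].
have uPhi x n : (forall m, ~ Phi m x) -> u n x = 0.
  move=> nx; apply: contrapT => /xsP[j xj]; apply: (nx j).
  have [K1 _ _] := Ks j; exists 1%g => //; exists x; last by rewrite mul1g.
  by exists j => /=; [exact: ltnSn|right].
have /choice[v vP] : forall x, exists b,
    (forall N, Phi N x -> (forall m, (m < N)%N -> ~ Phi m x) -> b = u N x) /\
    ((forall N, ~ Phi N x) -> b = 0).
  move=> x; have [/ex_least[N Nx Nmin]|nx] := pselect (exists n, Phi n x).
    exists (u N x); split=> [N' N'x N'min|/(_ N)//].
    have [h|h|->//] := ltngtP N N'; first by have := N'min N h Nx.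
    by have := Nmin N' h N'x.
  by exists 0; split=> // N Nx; case: nx; exists N.
exists v; split=> [x|n g Eg].
  have [/ex_least[N Nx Nmin]|nx] := pselect (exists n, Phi n x).
    by right; exists N; exact: (vP x).1.
  by left; apply: (vP x).2 => N Nx; apply: nx; exists N.
(* From [M] on, [g] belongs to all [K m], so [Phi m] is [g]-invariant. *)
have [N0 gN0] := EK _ _ Eg; pose M := maxn n N0.
have gM m : (M <= m)%N -> K m g.
  by move=> Mm; apply: gN0; apply: leq_trans Mm; exact: leq_maxr.
have -> : v - u n = (v - u M) + (u M - u n) by rewrite addrA subrK.
apply: almost_invD; last first.
  have : (n <= M)%N by exact: leq_maxl.
  elim: {gM}M => [|m IH].
    by rewrite leqn0 => /eqP->; rewrite subrr; exact: almost_inv0.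
  rewrite leq_eqVlt => /orP[/eqP->|nm].
    rewrite subrr; exact: almost_inv0.
  have -> : u m.+1 - u n = (u m.+1 - u m) + (u m - u n) by rewrite addrA subrK.
  by apply: almost_invD; [apply: Eu; exact: Ele Eg|exact: IH].
apply: sub_finite_set (fPhi M) => x /= gx; apply: contrapT => nMx; apply: gx.
have nPhig m : ~ Phi m x -> ~ Phi m (g * x)%g.
  move=> nmx mgx; have [Mm|mM] := leqP M m.
    by apply/nmx/(PhiK m g x (gM m Mm)).
  by apply/nMx/(PhiK M g x (gM M (leqnn M))); apply: Phile mgx; exact: ltnW.
rewrite /= -[LHS]/(v (g * x)%g - u M (g * x)%g) -[RHS]/(v x - u M x).
have [/ex_least[N Nx Nmin]|nx] := pselect (exists n, Phi n x); last first.
  have nx' m : ~ Phi m x by move=> mx; apply: nx; exists m.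
  have ngx m : ~ Phi m (g * x)%g by exact: nPhig.
  by rewrite !uPhi // (vP x).2 // (vP (g * x)%g).2.
have MN : (M < N)%N by rewrite ltnNge; apply/negP => /Phile/(_ _ Nx).
rewrite ((vP x).1 N) // ((vP (g * x)%g).1 N); first last.
- by move=> m /Nmin /nPhig.
- by apply/PhiK => //; apply: gM; exact: ltnW.
elim: N MN Nmin {Nx} => // N IH; rewrite ltnS leq_eqVlt.
have step : (M <= N)%N -> ~ Phi N x ->
    u N.+1 (g * x)%g - u N (g * x)%g = u N.+1 x - u N x.
  move=> MN nNx; apply: contrapT => h; apply: nNx; apply: FPhi.
  by exists g => //; exact: gM.
case/orP => [/eqP MN|MN] Nmin.
  by rewrite MN; apply: step; [rewrite MN|exact: Nmin].
have -> y : u N.+1 y - u M y = (u N.+1 y - u N y) + (u N y - u M y).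
  by rewrite addrA subrK.
rewrite step ?IH ?addrA ?subrK //; first by move=> m mN; apply: Nmin; exact: ltnW.
  exact: ltnW.
by apply: Nmin.
Qed.

(** * The coherent family *)

(** Let [M] be a countable group containing [H] and [k].  On far away cosets
    [M t_n] place the indicator of [K_n t_n], for finite subgroups [K_n]
    exhausting [H], times a coordinate [a |-> a i]; every [i] in [H] is used for
    infinitely many [n].  An element of [H] lies in almost all [K_n], so it
    moves only finitely many points across the boundary.  If [w] is almost
    [k]-invariant, it is exactly [k]-invariant on almost all [M t_n].  On such a
    coset the level set of [w] through [t_n] meets [H t_n] in [K_n t_n] and is
    [H]-invariant elsewhere, which [pingpong] excludes. *)
Lemma unabsorbable_function (G : groupType) (A : zmodType) (H : set G) (k : G) :
  locally_finite G -> ~ countable [set: G] -> countable H ->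
  ~ finite_set H -> subgroup H -> ~ H k ->
  exists d : G -> (G -> A) -> A,
    [/\ countable [set x | d x <> 0],
        forall x, d x = 0 \/ exists i, d x = fun a => a i,
        forall h, H h -> almost_inv h d &
        forall (a : G -> A) i, H i -> a i <> 0 ->
          forall w : G -> A, almost_inv k w ->
          ~ (forall h x, H h -> ~ H x ->
               w (h * x)%g + d (h * x)%g a = w x + d x a)].
Proof.
move=> lfG ncG cH iH Hs nHk; have [H1 HM HV] := Hs.
have [M [cM HkM Ms]] := countable_subgroup (countable_setU cH (countable1 k)).
have HsM : H `<=` M by move=> x Hx; apply: HkM; left.
have Mk : M k by apply: HkM; right.
have [M1 MM MV] := Ms.
have wf_ltn : well_founded (fun m n => m < n)%N.
  by elim/ltn_ind=> n IH; constructor=> m; exact: IH.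
(* Representatives of different cosets of [M], all different from [M]. *)
have [||t tP] := @wf_choice nat G _ 1%g
  (fun n f u => ~ M u /\ forall m, (m < n)%N -> ~ M (u * (f m)^-1)%g) wf_ltn.
- move=> n f g u fg [nu uf]; split=> // m mn.
  by rewrite -(fg m mn); exact: uf.
- move=> n f _; pose D := \bigcup_m [set (y * f m)%g | y in M].
  have cD : countable (M `|` D).
    by apply: countable_setU => //; apply: bigcup_countable => // m _;
       exact: countable_image.
  have [u /not_orP[nMu nDu]] := uncountable_avoid ncG cD.
  exists u; split=> // m _ Mum; apply: nDu; exists m => //.
  by exists (u * (f m)^-1)%g => //; rewrite mulgVK.
have nMt n y : M y -> ~ M (y * t n)%g.
  by move=> My; rewrite subgroup_mull //; exact: (tP n).1.
have t_uniq m n y z : M y -> M z -> (y * t m = z * t n)%g -> m = n.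
  have main i j (x x' : G) : M x -> M x' -> (x * t i = x' * t j)%g -> ~ (i < j)%N.
    move=> Mx Mx' E ij; apply: ((tP j).2 _ ij).
    by rewrite -(subgroup_mull _ Ms Mx') mulgA -E mulgK.
  move=> My Mz E; have [mn|nm|//] := ltngtP m n.
    by case: (main m n y z My Mz E mn).
  by case: (main n m z y Mz My (esym E) nm).
have /choice[idx idxP] : forall x, exists n,
    forall m y, M y -> x = (y * t m)%g -> n = m.
  move=> x; have [[m [y My xE]]|nx] :=
    pselect (exists m, exists2 y, M y & x = (y * t m)%g).
    by exists m => m' y' My'; rewrite xE => /t_uniq; apply.
  by exists 0%N => m y My xE; case: nx; exists m; exists y.
have {}idxP n y : M y -> idx (y * t n)%g = n.
  by move=> My; exact: (idxP _ n y My erefl).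
have [K [fK Ks KH Kle EK]] := @subgroup_exhaustion _ (fun=> H) lfG
  (fun _ _ _ => @subset_refl _ _)
  (bigcup_countable (countableP _) (fun _ _ => cH)).
have {}KH n : K n `<=` H by move=> x /KH; apply: gen_subgroup_sub.
have [e eE] := countable_enum cH H1.
(* Decoding [n] as a pair lists every element of [H] infinitely often. *)
pose i_ n := e (odflt (0, 0)%N (choice.unpickle n)).1.
pose d x : (G -> A) -> A :=
  if `[< K (idx x) (x * (t (idx x))^-1)%g >] then fun a => a (i_ (idx x)) else 0.
have dE n y : M y ->
    d (y * t n)%g = if `[< K n y >] then fun a => a (i_ n) else 0.
  by move=> My; rewrite /d idxP // mulgK.
have d_out x : (forall n, ~ M (x * (t n)^-1)%g) -> d x = 0.
  move=> nx; rewrite /d; case: asboolP => // /KH/HsM h.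
  by case: (nx (idx x)).
exists d; split.
- have : countable (\bigcup_n [set (y * t n)%g | y in M]).
    by apply: bigcup_countable => // n _; exact: countable_image.
  apply: sub_countable; apply: subset_card_le => x /= dx.
  apply: contrapT => nx; apply: dx; apply: d_out => n Mx; apply: nx.
  by exists n => //; exists (x * (t n)^-1)%g => //; rewrite mulgVK.
- by move=> x; rewrite /d; case: ifP => _; [right; exists (i_ (idx x))|left].
- move=> h Hh; have [N hN] := EK 0%N _ Hh.
  pose S n := [set x | K n (x * (t n)^-1)%g].
  have fS n : finite_set (S n).
    apply: sub_finite_set (finite_image (fun y => y * t n)%g (fK n)) => x Sx.
    by exists (x * (t n)^-1)%g => //; rewrite mulgVK.
  have : finite_set (\bigcup_(n in `I_N) (S n `|` [set x | S n (h * x)%g])).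
    apply: bigcup_finite => // n _; rewrite finite_setU; split=> //.
    exact: finite_preimage_mul.
  apply: sub_finite_set => x /= hx; apply: contrapT => nx; apply: hx.
  have [[n Mx]|nMx] := pselect (exists n, M (x * (t n)^-1)%g); last first.
    rewrite !d_out // => n Mx; apply: nMx; exists n => //.
    by move: Mx; rewrite -mulgA subgroup_mull //; exact: HsM.
  have xE : x = (x * (t n)^-1 * t n)%g by rewrite mulgVK.
  have MhX : M (h * (x * (t n)^-1))%g by apply: MM => //; exact: HsM.
  rewrite xE mulgA !dE //; have [nN|Nn] := ltnP n N; last first.
    have KE := subgroup_mull (x * (t n)^-1)%g (Ks n) (hN n Nn).
    by congr (if _ then _ else _); apply/asboolP/asboolP => /KE.
  case: asboolP => [h1|h1].
    by case: nx; exists n => //; right; rewrite /S/= -mulgA.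
  by case: asboolP => [h2|//]; case: nx; exists n => //; left.
move=> a i Hi ai w kw wH.
have [j ij] : exists j, e j = i by move: Hi; rewrite -eE => -[j _ <-]; exists j.
(* Some coset labelled by [i] avoids the finitely many points that [k] moves
   across level sets of [w]. *)
have [m nm] : exists m : nat,
    ~ (idx @` [set x | w (k * x)%g <> w x]) (choice.pickle (j, m)).
  apply: contrapT => hm; have /finite_setPn := finite_image idx kw; apply.
  apply/card_leT_ex; exists (fun m => choice.pickle (j, m)).
    by move=> m m' /(pcan_inj (@choice.pickleK (nat * nat)%type)) [].
  by move=> m; apply: contrapT => nm; apply: hm; exists m.
set n := choice.pickle _ in nm.
have in_ : i_ n = i by rewrite /i_ /n choice.pickleK.
have wk y : M y -> w (k * (y * t n))%g = w (y * t n)%g.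
  move=> My; apply: contrapT => wy; apply: nm.
  by exists (y * t n)%g => //; exact: idxP.
have [h Hh nKh] : exists2 h, H h & ~ K n h.
  apply: contrapT => hK; apply: iH; apply: sub_finite_set (fK n) => h Hh.
  by apply: contrapT => nKh; apply: hK; exists h.
have [K1 _ _] := Ks n.
pose P y := M y /\ w (y * t n)%g = w (t n).
have [l] := locally_finite_torsion (h * k)%g lfG.
apply: (@pingpong _ H P) => //.
- move=> y; rewrite /P subgroup_mull //; split=> -[My E]; split=> //.
    by rewrite -wk // mulgA.
  by rewrite -mulgA wk.
- move=> g y Hg nHy [My E]; split; first by apply: MM => //; exact: HsM.
  have := wH g (y * t n)%g Hg (fun h => nMt n y My (HsM _ h)).
  rewrite mulgA !dE //; last by apply: MM => //; exact: HsM.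
  rewrite !asboolF; first by rewrite !addr0 E.
    by move/KH.
  by move/KH; rewrite subgroup_mull.
- by split=> //; rewrite mul1g.
- move=> [_ E]; have nHt : ~ H (t n) by move=> /HsM; exact: (tP n).1.
  have := wH h (t n) Hh nHt; rewrite E -{4}(mul1g (t n)) !dE //; last exact: HsM.
  rewrite asboolF // asboolT // in_ => /addrI/esym; exact: ai.
Qed.

(** Evaluation at the parameter [a] turns [f] into a coherent family of
    functions [G -> A], additively in [a].  The last property says that this
    family is globally trivial only for [a = 0]. *)
Lemma coherent_family (G : groupType) (A : zmodType) (lt : G -> G -> Prop) :
  locally_finite G -> ~ countable [set: G] -> omega1_order lt ->
  exists f : G -> G -> (G -> A) -> A,
    [/\ forall al x a b, f al x (a - b) = f al x a - f al x b,
        forall g al be, leq_of lt g al -> leq_of lt g be ->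
          almost_inv g (f be - f al) &
        forall (a : G -> A) (F : G -> A),
          (forall g, almost_inv g (fun x => F x - f g x a)) -> a = 0].
Proof.
move=> lfG ncG olt; have [wf tr tri seg] := olt.
have ltxx x : ~ lt x x by elim/(well_founded_ind wf): x => x IH /[dup] xx /IH.
pose H al := [set y | lt y al].
(* The last requirement is void, and [d] is zero, unless the segment is an
   infinite subgroup. *)
have /choice[d dP] : forall al, exists d : G -> (G -> A) -> A,
    [/\ countable [set x | d x <> 0],
        forall x, d x = 0 \/ exists i, d x = fun a => a i,
        forall h, H al h -> almost_inv h d &
        ~ finite_set (H al) -> subgroup (H al) ->
        forall (a : G -> A) i, H al i -> a i <> 0 ->
          forall w : G -> A, almost_inv al w ->
          ~ (forall h x, H al h -> ~ H al x ->
               w (h * x)%g + d (h * x)%g a = w x + d x a)].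
  move=> al; have [[iH Hs]|nH] :=
    pselect (~ finite_set (H al) /\ subgroup (H al)).
    have [d [? ? ? ?]] :=
      unabsorbable_function A lfG ncG (seg al) iH Hs (@ltxx al).
    by exists d; split.
  exists (fun _ => 0); split=> //.
  - by apply: sub_countable (countable0 G); apply: subset_card_le => x /=.
  - by move=> x; left.
  - by move=> h _; exact: almost_inv0.
  - by move=> h1 h2; case: nH.
pose B : zmodType := (G -> A) -> A.
pose Q (al : G) (v : G -> G -> B) (w : G -> B) :=
  (forall x, w x = 0 \/ exists2 be, lt be al & w x = v be x + d be x) /\
  (forall be g, lt be al -> leq_of lt g be -> almost_inv g (w - (v be + d be))).
(* The supports are countable because values only come from the countably many
   earlier functions and from [d]. *)
have cQ v al : (forall be, leq_of lt be al -> Q be v (v be)) ->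
    countable [set x | (v al + d al) x <> 0].
  elim/(well_founded_ind wf): al => al IH Qv.
  have : countable ([set x | d al x <> 0] `|`
      \bigcup_(be in H al) [set x | (v be + d be) x <> 0]).
    apply: countable_setU; first by case: (dP al).
    apply: bigcup_countable => [|be be_al]; [exact: seg|apply: IH => // ga ga_be].
    by apply: Qv; left; case: ga_be => [/tr/(_ be_al)|->].
  apply: sub_countable; apply: subset_card_le => x /= fx.
  apply: contrapT => /not_orP[/contrapT dx nb]; apply: fx.
  rewrite -[LHS]/(v al x + d al x) dx addr0.
  have [vQ _] := Qv al (or_intror erefl); have [->//|[be be_al ->]] := vQ x.
  by apply: contrapT => vx; apply: nb; exists be.
have cohQ v al be g : Q al v (v al) -> lt be al -> leq_of lt g be ->
    almost_inv g ((v al + d al) - (v be + d be)).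
  move=> [_ vQ] be_al g_be; rewrite addrAC; apply: almost_invD; first exact: vQ.
  by have [_ _ dH _] := dP al; apply: dH; case: g_be => [/tr/(_ be_al)|->].
have [||v vP] := @wf_choice G (G -> B) lt (fun _ => 0) Q wf.
- move=> al f g u fg [u1 u2]; split=> [x|be ga be_al]; last first.
    by rewrite -fg //; exact: u2.
  have [->|[be be_al ->]] := u1 x; first by left.
  by right; exists be => //; rewrite fg.
- move=> al v vQ.
  have [[b0 b0_al]|nal] := pselect (exists be, H al be); last first.
    exists 0; split=> [x|be g be_al]; first by left.
    by case: nal; exists be.
  have [s [s_al sS scof]] := cofinal_sequence olt (seg al) b0_al.
  have le_tr := leq_of_trans olt.
  have s_mono m n : (m <= n)%N -> leq_of lt (s m) (s n).
    elim: n => [|n IH]; first by rewrite leqn0 => /eqP->; right.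
    by rewrite leq_eqVlt => /orP[/eqP->|/IH h]; [right|exact: le_tr (sS n)].
  have [||||w [w1 w2]] := @almost_inv_limit G B
      (fun n => [set g | leq_of lt g (s n)]) (fun n => v (s n) + d (s n)) lfG.
  + by move=> m n mn g gm; apply: le_tr (s_mono _ _ mn).
  + apply: bigcup_countable => // n _; apply: countable_setU; first exact: seg.
    exact: countable1.
  + move=> n; apply: cQ => be be_n; apply: vQ.
    by case: be_n => [/tr/(_ (s_al n))//|->]; apply: s_al.
  + move=> n g gn; have [lt_n|<-] := sS n; last first.
      rewrite subrr; exact: almost_inv0.
    by apply: cohQ lt_n gn; apply/vQ/s_al.
  exists w; split=> [x|be g be_al g_be].
    have [->|[n ->]] := w1 x; first by left.
    by right; exists (s n) => //; exact: s_al.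
  have [n be_n] := scof _ be_al.
  have wn : almost_inv g (w - (v (s n) + d (s n))).
    by apply: w2; exact: le_tr be_n.
  case: be_n => [be_n|->] //.
  rewrite -(subrK (v (s n) + d (s n)) w) -addrA; apply: almost_invD => //.
  by apply: cohQ => //; apply/vQ/s_al.
pose f al := v al + d al.
have fE al x : f al x = v al x + d al x by [].
have cf al : countable [set x | f al x <> 0] by apply: cQ.
exists f; split.
- have dB al x a b : d al x (a - b) = d al x a - d al x b.
    have [_ dv _ _] := dP al; have [->|[i ->]//] := dv x.
    by rewrite -[LHS]/(0 : A) -[RHS]/(0 - 0 : A) subr0.
  elim/(well_founded_ind wf) => al IH x a b.
  have E c : f al x c = v al x c + d al x c by [].
  rewrite !E dB opprD addrACA; congr (_ + _).
  have [v1 _] := vP al; have [->|[be be_al ->]] := v1 x.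
    by rewrite -[LHS]/(0 : A) -[RHS]/(0 - 0 : A) subr0.
  exact: IH.
- have coh g al be : lt be al -> leq_of lt g be -> almost_inv g (f al - f be).
    by move=> be_al g_be; apply: cohQ.
  move=> g al be gal gbe.
  have [->|/tri[al_be|be_al]] := pselect (al = be).
  + rewrite subrr; exact: almost_inv0.
  + exact: coh.
  + by apply: sub_finite_set (coh g _ _ be_al gbe) => x /= h1 h2; apply: h1;
      rewrite -opprB -[LHS]/(- (f al - f be) (g * x)%g) h2.
move=> a F FP; apply/funext=> i; rewrite -[RHS]/(0 : A); apply: contrapT => ai.
have [s s_inj _] : exists2 s : nat -> G, injective s & forall n, [set: G] (s n).
  by apply/card_leT_ex/infiniteP => /finite_set_countable.
have cF g : countable [set z | F (g * z)%g <> F z].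
  have cfg : countable [set z | f g (g * z)%g <> 0].
    have := countable_image (fun z => g^-1 * z)%g (cf g).
    apply: sub_countable; apply: subset_card_le => z fz.
    by exists (g * z)%g => //; rewrite mulKg.
  have := countable_setU (countable_setU (cf g) cfg)
    (finite_set_countable (FP g)).
  apply: sub_countable; apply: subset_card_le => z /= Fz.
  apply: contrapT => /not_orP[/not_orP[/contrapT f1 /contrapT f2] /contrapT].
  by rewrite f1 f2 -[X in _ - X]/(0 : A) !subr0.
(* Close off: [V] is a countable segment and a subgroup, contains the supports
   of all [f x] with [x] in [V], and [F] is [V]-invariant outside [V]. *)
have [||V [cV CV phiV]] := @countable_closure G (i |` range s)
    (fun x y => ([set (x * y)%g; (x^-1)%g] `|` H x) `|`
       ([set z | f x z <> 0] `|` [set z | F (x * z)%g <> F z])).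
- by apply: countable_setU => //; apply: countable_image.
- move=> x y; apply: countable_setU; last exact: countable_setU.
  apply: countable_setU; last exact: seg.
  by apply: finite_set_countable; apply: finite_set2.
have Vs : subgroup V.
  have VM x y : V x -> V y -> V (x * y)%g.
    by move=> Vx Vy; apply: (phiV x y) => //; left; left; left.
  have VV x : V x -> V x^-1%g.
    by move=> Vx; apply: (phiV x x) => //; left; left; right.
  have Vi : V i by apply: CV; left.
  by split=> //; rewrite -(mulgV i); apply/VM => //; exact: VV.
have iV : ~ finite_set V.
  move=> /finite_setPn; apply; apply/card_leT_ex; exists s => // n.
  by apply: CV; right; exists n.
have [de VE] : exists de, V = H de.
  apply: (omega1_segment olt ncG cV) => x y xy Vy.
  by apply: (phiV y y) => //; left; right.
have [_ _ _ bad] := dP de; rewrite -VE in bad.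
have Vi : V i by apply: CV; left.
apply: (bad iV Vs a i Vi ai (fun x => F x - f de x a) (FP de)).
have v0 x : ~ V x -> v de x = 0.
  move=> nVx; have [v1 _] := vP de; have [//|[be be_de vx]] := v1 x.
  apply: contrapT => vx0; apply: nVx; apply: (phiV be be); try by rewrite VE.
  by right; left; rewrite /= fE -vx.
move=> h x Vh nVx; rewrite !fE.
have E (c e : B) : (c + e) a = c a + e a by [].
have E0 : (0 : B) a = 0 by [].
rewrite !E !v0 ?subgroup_mull // !E0 !add0r !subrK.
apply: contrapT => Fx; apply: nVx; apply: (phiV h h) => //.
by right; right.
Qed.

(** * Coinduced modules and the cocycle of a coherent family *)

Section Coinduced.
Variables (G : groupType) (A : zmodType).

Definition coind_act (g : G) (u : G -> A) : G -> A := fun x => u (g^-1 * x)%g.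

Lemma coind_act_is_zmod_morphism g : zmod_morphism (coind_act g).
Proof. by []. Qed.
HB.instance Definition _ g :=
  GRing.isZmodMorphism.Build (G -> A) (G -> A) (coind_act g)
    (coind_act_is_zmod_morphism g).

Lemma coind_act1 u : coind_act 1%g u = u.
Proof. by apply/funext => x; rewrite /coind_act invg1 mul1g. Qed.

Lemma coind_actM g h u : coind_act (g * h)%g u = coind_act g (coind_act h u).
Proof. by apply/funext => x; rewrite /coind_act invgM mulgA. Qed.

Definition coinduced : gmodule G :=
  @GModule G (G -> A) (fun g => coind_act g : {additive _ -> _})
    coind_act1 coind_actM.

Definition malg_of (u : G -> A) : {malg A[G]} :=
  [malg k in fset_set [set x | u x <> 0] => u k].

Lemma mcoeff_malg_of u k : finite_set [set x | u x <> 0] -> (malg_of u)@_k = u k.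
Proof.
move=> fu; rewrite mcoeffE in_fset_set //; case: ifPn => //.
by rewrite notin_setE => /contrapT.
Qed.

Lemma finite_mcoeff_support (x : {malg A[G]}) : finite_set [set k | x@_k <> 0].
Proof.
apply: sub_finite_set (finite_fset (msupp x)) => k /= xk.
by rewrite -mcoeff_neq0; apply/eqP.
Qed.

Definition coeffs (x : induced G A) : coinduced :=
  fun k => (x : {malg A[G]})@_k.

Lemma coeffs_cobd1 (c : cochain (induced G A) 1) s :
  coeffs (cobd c s) = cobd (coeffs \o c : cochain coinduced 1) s.
Proof.
apply/funext => k; rewrite !cobd1E /coeffs.
by rewrite mcoeffD mcoeffB mcoeff_ltrans.
Qed.

Lemma coeffs_cobd2 (c : cochain (induced G A) 2) s :
  coeffs (cobd c s) = cobd (coeffs \o c : cochain coinduced 2) s.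
Proof.
apply/funext => k; rewrite !cobd2E /coeffs.
by rewrite mcoeffB mcoeffD mcoeffB mcoeff_ltrans.
Qed.

(** Vanishing of [H^1] of a coinduced module: the cocycle identity for the
    pair [(g, g^-1 x)], evaluated at [x], makes the diagonal values
    [c x x] a primitive up to sign. *)
Lemma coinduced_cocycle1 (c : cochain coinduced 1) : cobd c = 0 ->
  exists F : G -> A, forall g x, (c (fun=> g) : G -> A) x = F (g^-1 * x)%g - F x.
Proof.
move=> c0; pose D x := (c (fun=> x) : G -> A) x.
exists (fun x => - D x) => g x; apply/eqP; rewrite opprK addrC -subr_eq0 opprB.
have E : cobd c (pair_fun g (g^-1 * x)%g) = 0 by rewrite c0.
have {E} := congr1 (fun u : G -> A => u x) E.
rewrite cobd1E /pair_fun /= mulVKg -[RHS]/(0 : A) => E.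
by apply/eqP; rewrite [LHS]addrC -[RHS]E.
Qed.

End Coinduced.

(** The cochain [ct a] sends [g] to [g (f g) - f g]; its coboundary is
    finitely supported, and so is a 2-cocycle in the induced module: this is the
    connecting map of the quotient of the coinduced by the induced module. *)
Lemma connecting_cocycle (G : groupType) (A : zmodType) (lt : G -> G -> Prop)
    (f : G -> G -> (G -> A) -> A) :
  omega1_order lt ->
  (forall g x a b, f g x (a - b) = f g x a - f g x b) ->
  (forall g al be, leq_of lt g al -> leq_of lt g be ->
     almost_inv g (f be - f al)) ->
  exists Z : (G -> A) -> cochain (induced G A) 2,
    [/\ zmod_morphism Z, forall a, cobd (Z a) = 0 &
        forall a c, Z a = cobd c ->
          exists F : G -> A, forall g, almost_inv g (fun x => F x - f g x a)].
Proof.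
move=> olt fB fcoh.
pose ct a : cochain (coinduced G A) 1 := fun s =>
  (fun x => f (s ord0) ((s ord0)^-1 * x)%g a - f (s ord0) x a) : G -> A.
have ctB : zmod_morphism ct.
  move=> a b; apply/funext => s; apply/funext => x.
  rewrite -[RHS]/((ct a s : G -> A) x - (ct b s : G -> A) x) /ct.
  by rewrite !fB opprD addrACA -opprD.
have fin a s : finite_set [set x | (cobd (ct a) s : G -> A) x <> 0].
  pose g := s ord0; pose h := s ord_max.
  (* Replacing [f g], [f h] and [f (g * h)] by one later [f m] changes values
     at finitely many points only, and leaves an exact cocycle. *)
  have [m [gm hm ghm]] := leq_of_ub g h (g * h)%g olt.
  pose e k x := (f k x a - f m x a).
  have fe k : leq_of lt k m -> finite_set [set x | e k (k^-1 * x)%g - e k x <> 0].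
    move=> km; have [_ _ aiV] := almost_inv_subgroup (f k - f m).
    have := aiV k (fcoh k m k km (or_intror erefl)).
    apply: sub_finite_set => x /= ex E; apply: ex.
    rewrite /e -[f k (k^-1 * x)%g a - _]/((f k - f m) (k^-1 * x)%g a) E.
    exact: subrr.
  have f1 := finite_preimage_mul g^-1%g (fe h hm).
  have f2 := fe (g * h)%g ghm; have f3 := fe g gm.
  have : finite_set ([set x | e h (h^-1 * (g^-1 * x))%g - e h (g^-1 * x)%g <> 0]
    `|` [set x | e (g * h)%g ((g * h)^-1 * x)%g - e (g * h)%g x <> 0]
    `|` [set x | e g (g^-1 * x)%g - e g x <> 0]).
    by rewrite !finite_setU.
  apply: sub_finite_set => x /=; rewrite cobd1E -/g -/h => nx.
  apply: contrapT => /not_orP[/not_orP[/contrapT e1 /contrapT e2] /contrapT e3].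
  apply: nx.
  rewrite -[LHS]/((f h (h^-1 * (g^-1 * x))%g a - f h (g^-1 * x)%g a)
    - (f (g * h)%g ((g * h)^-1 * x)%g a - f (g * h)%g x a)
    + (f g (g^-1 * x)%g a - f g x a)).
  have E k y : f k y a = e k y + f m y a by rewrite /e subrK.
  have D k y y' : f k y a - f k y' a = (e k y - e k y') + (f m y a - f m y' a).
    by rewrite (E k y) (E k y') opprD addrACA.
  rewrite (D h) (D (g * h)%g) (D g) e1 e2 e3 !add0r invgM mulgA opprB.
  set p := f m _ a; set q := f m _ a; set r := f m x a.
  by rewrite -addrA (addrC (r - p)) (addrA (q - r)) subrK addrA subrK subrr.
pose Z a : cochain (induced G A) 2 := fun s => malg_of (cobd (ct a) s).
have ZE a s : coeffs (Z a s) = cobd (ct a) s.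
  by apply/funext => x; rewrite /coeffs mcoeff_malg_of.
have coeffs_inj : injective (@coeffs G A).
  by move=> x y xy; apply/malgP => k; have := congr1 (fun u : G -> A => u k) xy.
exists Z; split.
- move=> a b; apply/funext => s; apply: coeffs_inj; apply/funext => x.
  rewrite ZE -[RHS]/(coeffs (Z a s - Z b s) x) /coeffs mcoeffB.
  by rewrite -!/(coeffs _ _) !ZE ctB raddfB.
- move=> a; apply/funext => s; apply: coeffs_inj; rewrite coeffs_cobd2.
  have -> : @coeffs G A \o Z a = cobd (ct a) by apply/funext => t; exact: ZE.
  by rewrite cobd_cobd1; apply/funext => x; rewrite /coeffs mcoeff0.
move=> a c Zc.
(* If [Z a] is the coboundary of [c], then [ct a - c] is a cocycle. *)
have [|F FE] := @coinduced_cocycle1 G A (ct a - (@coeffs G A \o c)).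
  rewrite raddfB /=; apply/eqP; rewrite subr_eq0; apply/eqP/funext => s.
  by rewrite -ZE Zc coeffs_cobd1.
exists F => g.
have [_ _ aiV] := almost_inv_subgroup (fun x => F x - f g x a).
move: (aiV g^-1%g); rewrite /= invgK; apply; rewrite /almost_inv.
have fc := finite_mcoeff_support (c (fun=> g) : {malg A[G]}).
apply: sub_finite_set fc => x /= Fx cx; apply: Fx.
have {FE} := FE g x.
rewrite -[LHS]/((f g (g^-1 * x)%g a - f g x a)
  - (c (fun=> g) : {malg A[G]})@_x).
rewrite cx subr0 => E; apply/eqP.
by rewrite subr_eq -addrA [- _ + _]addrC E addrC subrK.
Qed.

(** * Cardinalities *)

Definition extend (X Y : Type) (A : zmodType) (e : X -> Y) (u : X -> A)
    (y : Y) : A :=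
  if pselect (exists x, e x = y) is left h then u (projT1 (cid h)) else 0.

Lemma extendE (X Y : Type) (A : zmodType) (e : X -> Y) (u : X -> A) x :
  injective e -> extend e u (e x) = u x.
Proof.
move=> e_inj; rewrite /extend; case: pselect => [h|[]]; last by exists x.
by case: (cid h) => x' /= /e_inj ->.
Qed.

Lemma extend_inj (X Y : Type) (A : zmodType) (e : X -> Y) :
  injective e -> injective (@extend X Y A e).
Proof.
move=> e_inj u v uv; apply/funext => x.
by rewrite -(extendE u x e_inj) uv extendE.
Qed.

Lemma extendB (X Y : Type) (A : zmodType) (e : X -> Y) :
  zmod_morphism (@extend X Y A e).
Proof.
move=> u v; apply/funext => y.
rewrite -[RHS]/(extend e u y - extend e v y) /extend.
by case: pselect => [h|nh] //; rewrite subr0.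
Qed.

Lemma zmodClosed_image (U V : zmodType) (phi : {additive U -> V}) :
  injective phi ->
  exists S : zmodClosed V, set_bij [set: U] [set` S] phi.
Proof.
move=> phi_inj; pose S : {pred V} := fun y => `[< exists x, phi x = y >].
have Sclosed : zmod_closed S.
  split; first by apply/asboolP; exists 0; rewrite raddf0.
  move=> y z /asboolP[u <-] /asboolP[v <-].
  by apply/asboolP; exists (u - v); rewrite raddfB.
pose S' : zmodClosed V := HB.pack S (GRing.isZmodClosed.Build V S Sclosed).
exists S'; split.
- by move=> x _; apply/asboolP; exists x.
- by move=> x y _ _ /phi_inj.
- by move=> y /asboolP[x <-]; exists x.
Qed.

Lemma card_cohomology2_le (G : groupType) (A : zmodType) :
  (exists e : G * G -> G, injective e) ->
  [set: cohomology (induced G A) 2] #<= [set: G -> A].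
Proof.
move=> [e e_inj].
pose e3 (p : G * G * G) := e (e p.1, p.2).
have e3_inj : injective e3.
  by move=> [[x y] z] [[x' y'] z'] /e_inj /= [/e_inj [-> ->] ->].
pose values (q : cohomology (induced G A) 2) (p : G * G * G) : A :=
  (val (repr q) (pair_fun p.1.1 p.1.2) : {malg A[G]})@_p.2.
apply/card_leT_ex; exists (extend e3 \o values) => //.
apply: inj_comp (extend_inj e3_inj) _ => q q' qq'.
rewrite -(reprK q) -(reprK q'); congr (\pi%qT _); apply/val_inj/funext => s.
have -> : s = pair_fun (s ord0) (s ord_max).
  apply/funext => i; rewrite /pair_fun; case: eqP => [->//|i0]; congr s.
  by apply/val_inj; case: i i0 => [[|[|//]] hi] //= [] ; apply/val_inj.
apply/malgP => k.
exact: (congr1 (fun u => u (s ord0, s ord_max, k)) qq').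
Qed.

Theorem theorem5p4 (G : groupType) (A : zmodType) (I : Type)
    (G_lf : locally_finite G) (G_card : card_aleph1 G) (I_card : card_aleph1 I) :
  (exists (S : zmodClosed (cohomology (induced G A) 2))
          (phi : {additive (I -> A) -> cohomology (induced G A) 2}),
     set_bij [set: I -> A] [set` S] phi) /\
  [set: cohomology (induced G A) 2] #= [set: G -> A] /\
  [set: G -> A] #= [set: I -> A].
Proof.
have [ncG [lt olt]] := card_aleph1_order G_card.
have [ncI [ltI oltI]] := card_aleph1_order I_card.
have [iota iota_inj] : exists i : I -> G, injective i.
  have [i i_inj] := omega1_nat_inj oltI ncG; exists (fun x => i (x, 0%N)).
  by move=> x y /i_inj [].
have [iota' iota'_inj] : exists i : G -> I, injective i.
  have [i i_inj] := omega1_nat_inj olt ncI; exists (fun x => i (x, 0%N)).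
  by move=> x y /i_inj [].
have [f [fB fcoh fnt]] := coherent_family A G_lf ncG olt.
have [Z [ZB Z0 Znt]] := connecting_cocycle olt fB fcoh.
have Zc a : Z a \in @is_cocycle G (induced G A) 2 by apply/eqP; exact: Z0.
pose phi (a : I -> A) : cohomology (induced G A) 2 :=
  \pi_({ideal_quot @is_coboundary G (induced G A) 2})%qT
    (Cocycle (Zc (extend iota a))).
have phiB : zmod_morphism phi.
  move=> a b; rewrite /phi -raddfB; congr (\pi%qT _); apply/val_inj.
  by rewrite /= extendB ZB.
pose Phi : {additive (I -> A) -> cohomology (induced G A) 2} :=
  HB.pack phi (GRing.isZmodMorphism.Build _ _ phi phiB).
have phi_inj : injective Phi.
  apply: raddf_inj => a /eqP.
  rewrite -[X in _ == X](raddf0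
    \pi_({ideal_quot @is_coboundary G (induced G A) 2})%qT).
  rewrite -[_ == _]Quotient.idealrBE subr0 => /asboolP[c Zc'].
  have [F /fnt ext0] := Znt _ c Zc'.
  by apply: (extend_inj iota_inj); rewrite ext0 -(subrr 0) extendB subrr.
split; last split.
- by have [S SP] := zmodClosed_image phi_inj; exists S, Phi.
- apply/card_eqPle; split.
    by apply: card_cohomology2_le; exact: omega1_square_inj olt ncG.
  apply/card_leT_ex; exists (Phi \o extend iota') => //.
  exact: inj_comp phi_inj (extend_inj iota'_inj).
- apply/card_eqPle; split; apply/card_leT_ex.
    by exists (extend iota') => //; exact: extend_inj.
  by exists (extend iota) => //; exact: extend_inj.
Qed.
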